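(* Let $F_0\in\mathbb{C}[W_0,\dots,W_{n+1}]^{\mathfrak{S}_{n+2}}$ be a homogeneous polynomial of degree $d=n+2$, invariant under the symmetric group $\mathfrak{S}_{n+2}$ permuting the variables, such that the (Calabi–Yau) hypersurface $X_0=\{F_0=0\}\subset\mathbb{P}^{n+1}$ has only isolated singularities. Then $X_0$ does not contain a node whose stabilizer in $\mathfrak{S}_{n+2}$ (acting on $\mathbb{P}^{n+1}$ by permuting coordinates) is trivial.
   Context: A node (ordinary double point) of the $n$-dimensional hypersurface $X_0$ is a singular point near which $X_0$ is locally analytically isomorphic to $\{\sum_{i=1}^{n+1}z_i^2=0\}\subset\mathbb{C}^{n+1}$. *)

(* Defs.v *)
From HB Require Import structures.
From mathcomp Require Import all_boot all_order all_algebra all_fingroup.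
(* mpoly must be imported before MathComp-Analysis: in the other order two of
   their notations clash. *)
From mathcomp Require Import mpoly.
From mathcomp Require Import boolp classical_sets reals topology normedtype.
From mathcomp Require Import derive.
Set Implicit Arguments.
Unset Strict Implicit.
Unset Printing Implicit Defensive.
Import Order.TTheory GRing.Theory Num.Theory numFieldNormedType.Exports.
Local Open Scope ring_scope.

(* These notions are meant for C = R[i] with R : realType, the field of complex
   numbers.  They are stated for a numClosedFieldType C because it is through
   this structure that C gets the topology of its modulus, and 'rV[C]_m that of
   the sup norm. *)

Section Germs.
Variable C : numClosedFieldType.
Implicit Types m : nat.

(* Complex-differentiable on a neighbourhood: over the complex numbers this is
   the same as being analytic. *)
Definition holomorphic_near m (W : normedModType C)
    (h : 'rV[C]_m -> W) (a : 'rV[C]_m) : Prop :=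
  \forall z \near a, differentiable h z.

(* The germ of h at a belongs to the ideal generated by f in the local ring of
   convergent power series at a. *)
Definition germ_dvd m (a : 'rV[C]_m) (f h : 'rV[C]_m -> C) : Prop :=
  exists2 g : 'rV[C]_m -> C,
    holomorphic_near g a & \forall z \near a, h z = g z * f z.

(* phi induces a morphism of germs of complex spaces
   ({f = 0}, a) -> ({g = 0}, b). *)
Definition germ_morphism m l (f : 'rV[C]_m -> C) (a : 'rV[C]_m)
    (g : 'rV[C]_l -> C) (b : 'rV[C]_l)
    (phi : 'rV[C]_m -> 'rV[C]_l) : Prop :=
  [/\ holomorphic_near phi a, phi a = b & germ_dvd a f (g \o phi)].

(* phi and phi' restrict to the same morphism on the germ ({f = 0}, a). *)
Definition germ_congr m l (a : 'rV[C]_m) (f : 'rV[C]_m -> C)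
    (phi phi' : 'rV[C]_m -> 'rV[C]_l) : Prop :=
  forall j, germ_dvd a f (fun z => phi z 0 j - phi' z 0 j).

(* Local analytic isomorphism ({f = 0}, a) ~ ({g = 0}, b).  Non-reduced
   structures are taken into account: everything is modulo the ideals (f) and
   (g), not merely on the zero sets. *)
Definition germ_isomorphic m l (f : 'rV[C]_m -> C) (a : 'rV[C]_m)
    (g : 'rV[C]_l -> C) (b : 'rV[C]_l) : Prop :=
  exists (phi : 'rV[C]_m -> 'rV[C]_l)
         (psi : 'rV[C]_l -> 'rV[C]_m),
    [/\ germ_morphism f a g b phi, germ_morphism g b f a psi,
        germ_congr a f (psi \o phi) id & germ_congr b g (phi \o psi) id].

End Germs.

(* A point of P^N is the line spanned by a nonzero row vector p of homogeneous
   coordinates; p and q give the same point when their row spaces agree, that is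
   (p == q)%MS. *)

Section Hypersurface.
Variables (C : numClosedFieldType) (n : nat).
Implicit Types (F : {mpoly C[n.+2]}) (p q : 'rV[C]_n.+2).

Definition singular_point F p : Prop :=
  [/\ p != 0, F.@[p 0] = 0 & forall i, (F^`M(i)).@[p 0] = 0].

(* The projection from nonzero vectors to the projective space is continuous
   and open, so neighbourhoods of the point spanned by p may be tested on
   neighbourhoods of the vector p. *)
Definition isolated_singularities F : Prop :=
  forall p, singular_point F p ->
    \forall q \near p, singular_point F q -> (q == p)%MS.

(* The affine chart {W_k != 0}: from_chart k inserts 1 at place k. *)
Definition from_chart (k : 'I_n.+2) (z : 'rV[C]_n.+1) : 'rV[C]_n.+2 :=
  \row_j (if unlift k j is Some j' then z 0 j' else 1).

Definition to_chart (k : 'I_n.+2) p : 'rV[C]_n.+1 :=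
  \row_j (p 0 (lift k j) / p 0 k).

Definition nondegenerate_quadric (z : 'rV[C]_n.+1) : C :=
  \sum_i z 0 i ^+ 2.

Definition node F p : Prop :=
  singular_point F p /\
  exists2 k : 'I_n.+2, p 0 k != 0 &
    germ_isomorphic (fun z => F.@[from_chart k z 0]) (to_chart k p)
                    nondegenerate_quadric 0.

(* Stabilizer of the projective point spanned by p, not of the vector p. *)
Definition proj_stabilizer p : {set 'S_n.+2} :=
  [set s : 'S_n.+2 | (col_perm s p == p)%MS]%SET.

End Hypersurface.

(* Main.v *)
Require Import Defs.
From HB Require Import structures.
From mathcomp Require Import all_boot all_order all_algebra all_fingroup.
From mathcomp Require Import complex.
From mathcomp Require Import mpoly.
From mathcomp Require Import boolp classical_sets reals topology normedtype.
From mathcomp Require Import derive.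
Set Implicit Arguments.
Unset Strict Implicit.
Unset Printing Implicit Defensive.
Import Order.TTheory GRing.Theory Num.Theory numFieldNormedType.Exports.
Local Open Scope ring_scope.
Local Open Scope complex_scope.

(** Write N = n + 2 and let e_1, ..., e_N be the elementary symmetric
    polynomials in the N coordinates.  The point of the proof is that a singular
    point p of X_0 whose stabilizer is trivial is never isolated: X_0 is singular
    along a whole curve through p.

    By the fundamental theorem, F_0 = t(e_1, ..., e_N), where t is homogeneous
    of weight N when its i-th variable has weight i.  A transposition of two
    equal coordinates would stabilize p, so the coordinates of p are distinct;
    then the Jacobian matrix of e = (e_1, ..., e_N) is invertible at p
    ([mesym_jacobian_unit]), and the chain rule turns dF_0(p) = 0 into
    dt(e(p)) = 0.  Since e_N already has weight N, the derivative of t in its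
    last variable is a constant ([mderiv_max_weight]); it vanishes at e(p), so it
    is zero and t does not involve e_N at all.  So if e_k(z) = e_k(p) for all
    k < N, then F_0(z) = F_0(p) = 0 and dt(e(z)) = dt(e(p)) = 0, hence
    dF_0(z) = 0: every such z is again a singular point
    ([singular_along_mesym_fiber]).

    Such z are obtained by adding a small constant c to the polynomial with
    roots p_1, ..., p_N: its roots move little ([roots_add_const_near]), and
    among its coefficients only the one that carries e_N changes.  It remains to
    see that z and p are different points of the projective space.  If some
    e_k(p) with 0 < k < N is nonzero, z = l p forces l^k = 1, hence |l| = 1 and
    |e_N(z)| = |e_N(p)|, which is avoided by the choice of c
    ([small_norm_change]).  If all these e_k(p) vanish, the coordinates of p are
    the N distinct roots of an equation T^N = a; multiplication by a ratio of two
    of them permutes the coordinates, so the stabilizer of p is not trivial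
    ([nontrivial_stabilizer_of_mesym0]). *)

(** * Elementary symmetric polynomials and roots *)

Lemma coef_prod_XsubC_mesym (R : idomainType) (N : nat) (v : 'I_N -> R) k :
  (k <= N)%N ->
  (\prod_(i < N) ('X - (v i)%:P))`_(N - k) = (-1) ^+ k * (mesym N R k).@[v].
Proof.
move=> le_kN.
have := mroots_coeff [tuple v i | i < N] (Ordinal (le_kN : (k < N.+1)%N)).
rewrite big_tuple /= => E.
under eq_bigr do rewrite -(tnth_mktuple v).
by rewrite E; congr (_ * _); apply: meval_eq => i; rewrite tnth_mktuple.
Qed.

(** The Vieta identity with a scalar in place of the indeterminate: both sides
    can then be differentiated in the variables of the polynomial ring, which
    gives the derivatives of all elementary symmetric polynomials at once. *)
Lemma prod_subX_mesym (R : idomainType) (N : nat) (c : R) :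
  \prod_(i < N) (c%:MP - 'X_i) =
  \sum_(k < N.+1) (-1) ^+ k * mesym N R k * (c ^+ (N - k))%:MP.
Proof.
pose P : {poly {mpoly R[N]}} := \prod_(i < N) ('X - ('X_i)%:P).
have -> : \prod_(i < N) (c%:MP - 'X_i) = P.[c%:MP].
  by rewrite horner_prod; apply: eq_bigr => i _; rewrite hornerXsubC.
rewrite (@horner_coef_wide _ N.+1); last first.
  by rewrite size_prod_XsubC -[index_enum _]enumT size_enum_ord.
rewrite [LHS](reindex_inj rev_ord_inj) /=; apply: eq_bigr => k _.
rewrite subSS coef_prod_XsubC_mesym -1?ltnS ?ltn_ord // -rmorphXn /=.
congr (_ * _ * _); rewrite /mesym raddf_sum /=; apply: eq_bigr => h _.
by rewrite rmorph_prod; apply: eq_bigr => i _; rewrite /= mevalXU.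
Qed.

(** Only the constant coefficient of the polynomial changes. *)
Lemma mesym_add_const (R : idomainType) (N : nat) (x z : 'I_N.+1 -> R) (c : R) :
  \prod_i ('X - (z i)%:P) = \prod_i ('X - (x i)%:P) + c%:P ->
  (forall k, (k <= N)%N -> (mesym N.+1 R k).@[z] = (mesym N.+1 R k).@[x]) /\
  (-1) ^+ N.+1 * (mesym N.+1 R N.+1).@[z] =
    (-1) ^+ N.+1 * (mesym N.+1 R N.+1).@[x] + c.
Proof.
move=> zx; split=> [k le_kN|]; last first.
  by rewrite -!coef_prod_XsubC_mesym // zx coefD subnn coefC.
apply: (@mulfI _ ((-1) ^+ k)); first by rewrite signr_eq0.
rewrite -!coef_prod_XsubC_mesym ?leqW // zx coefD coefC.
by rewrite subn_eq0 leqNgt ltnS le_kN addr0.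
Qed.

Lemma meval_mesym_scale (R : comNzRingType) (N k : nat) (l : R)
    (v : 'I_N -> R) :
  (mesym N R k).@[fun i => l * v i] = l ^+ k * (mesym N R k).@[v].
Proof.
rewrite /mesym !raddf_sum mulr_sumr /=; apply: eq_bigr => h /eqP <-.
rewrite !rmorph_prod /= -prodr_const -big_split /=.
by apply: eq_bigr => i _; rewrite !mevalXU.
Qed.

(** * The Jacobian of the elementary symmetric polynomials *)

Lemma mderiv_prod0 (R : nzRingType) (N : nat) (I : Type) (r : seq I)
    (P : pred I) (F : I -> {mpoly R[N]}) (k : 'I_N) :
  (forall i, P i -> (F i)^`M(k) = 0) -> (\prod_(i <- r | P i) F i)^`M(k) = 0.
Proof.
move=> F0; apply: (big_ind (fun q : {mpoly R[N]} => q^`M(k) = 0)) => //.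
  by rewrite mderivC.
by move=> p q p0 q0; rewrite mderivM p0 q0 mul0r mulr0 addr0.
Qed.

Lemma mderivXU (R : nzRingType) (N : nat) (i k : 'I_N) :
  ('X_i : {mpoly R[N]})^`M(k) = (i == k)%:R.
Proof.
rewrite mderivX mnm1E; case: eqP => [->|_]; last by rewrite scale0r.
by rewrite -[X in (X - _)%MM]add0m addmK mpolyX0 scale1r.
Qed.

Lemma mderiv_prod_subX (R : idomainType) (N : nat) (c : R) (k : 'I_N) :
  (\prod_(i < N) (c%:MP - 'X_i) : {mpoly R[N]})^`M(k) =
  - \prod_(i < N | i != k) (c%:MP - 'X_i).
Proof.
rewrite (bigD1 k) //= mderivM mderiv_prod0 ?mulr0 ?addr0; last first.
  by move=> i /negPf ik; rewrite mderivB mderivC mderivXU ik subr0.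
by rewrite mderivB mderivC mderivXU eqxx sub0r mulN1r.
Qed.

(** Let J be this matrix.  Differentiating in X_k the polynomial prod_i (c - X_i),
    expanded in the elementary symmetric polynomials, and then putting c = v_j
    and X = v, one finds that J multiplied on the left by a matrix of signed
    powers of the v_j is diagonal: prod_(i != k) (v_j - v_i) contains a zero
    factor unless j = k.  The diagonal entries are the products of the
    differences v_j - v_i, nonzero for distinct v_i. *)
Lemma mesym_jacobian_unit (F : fieldType) (N : nat) (v : 'I_N -> F) :
  injective v ->
  \matrix_(i < N, k < N) ((mesym N F i.+1)^`M(k)).@[v] \in unitmx.
Proof.
move=> v_inj; set J := \matrix_(i, k) _.
pose V := \matrix_(j < N, i < N) ((-1) ^+ i.+1 * v j ^+ (N - i.+1)).
suff : V *m J \in unitmx by rewrite unitmx_mul => /andP[].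
have -> : V *m J = diag_mx (\row_j - \prod_(i < N | i != j) (v j - v i)).
  apply/matrixP => j k; rewrite !mxE.
  (* The identity is differentiated first, with c = v_j constant, and only then
     evaluated at v. *)
  have := congr1 (fun q : {mpoly F[N]} => q^`M(k).@[v])
                 (prod_subX_mesym N (v j)).
  rewrite mderiv_prod_subX mevalN rmorph_prod /=.
  rewrite big_ord_recl mesym0E expr0 !mul1r mderivD mderivC add0r.
  rewrite (raddf_sum (mderiv k)) (raddf_sum (meval v)) /=.
  under eq_bigr do rewrite rmorphB /= mevalC mevalXU.
  have -> : (- \prod_(i < N | i != k) (v j - v i)) =
            (- \prod_(i < N | i != j) (v j - v i)) *+ (j == k).
    case: eqP => [->|/eqP jk]; first by rewrite mulr1n.
    by rewrite (bigD1 j) //= subrr mul0r oppr0.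
  move=> ->; apply: eq_bigr => i _; rewrite !mxE /=.
  rewrite -(rmorph_sign (@mpolyC N F)) mderivM mderivC mulr0 addr0 mderiv_mulC.
  by rewrite !mevalM !mevalC mulrAC.
rewrite unitmxE det_diag unitfE; apply/prodf_neq0 => j _; rewrite mxE oppr_eq0.
by apply/prodf_neq0 => i; rewrite subr_eq0; apply: contraNneq => /v_inj->.
Qed.

(** * Derivatives and the variables that a polynomial involves *)

Lemma mderiv_comp (R : comNzRingType) (n m : nat) (p : {mpoly R[n]})
    (lq : n.-tuple {mpoly R[m]}) (k : 'I_m) :
  (p \mPo lq)^`M(k) = \sum_(i < n) (p^`M(i) \mPo lq) * (tnth lq i)^`M(k).
Proof.
(* The set of q that satisfy the chain rule is a subalgebra that contains the
   variables. *)
pose chain q := (q \mPo lq)^`M(k) =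
  \sum_(i < n) (q^`M(i) \mPo lq) * (tnth lq i)^`M(k).
have chain1 : chain 1.
  rewrite /chain comp_mpoly1 mderivC big1 // => i _.
  by rewrite mderivC comp_mpoly0 mul0r.
have chainM p1 p2 : chain p1 -> chain p2 -> chain (p1 * p2).
  rewrite /chain rmorphM mderivM => -> ->.
  rewrite mulr_suml mulr_sumr -big_split /=; apply: eq_bigr => i _.
  by rewrite mderivM comp_mpolyD !rmorphM /= mulrDl mulrAC mulrA.
have chainX i : chain 'X_i.
  rewrite /chain comp_mpolyXU -tnth_nth (bigD1 i) //= mderivXU eqxx.
  rewrite comp_mpoly1 mul1r big1 ?addr0 // => j ji.
  by rewrite mderivXU eq_sym (negPf ji) comp_mpoly0 mul0r.
elim/mpolyind: p => [|c q p _ _ IHp].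
  rewrite comp_mpoly0 mderiv0 big1 // => i _.
  by rewrite mderiv0 comp_mpoly0 mul0r.
have chainq : chain 'X_[q].
  rewrite mpolyXE_id; apply: (big_ind chain) => // i _.
  by elim: (q i) => [|e IHe]; rewrite ?expr0 // exprS; apply: chainM.
rewrite comp_mpolyD comp_mpolyZ mderivD mderivZ {}IHp chainq.
rewrite scaler_sumr -big_split /=; apply: eq_bigr => i _.
by rewrite mderivD mderivZ comp_mpolyD comp_mpolyZ mulrDl scalerAl.
Qed.

(** In characteristic zero a polynomial with zero derivative in a variable does
    not involve this variable. *)
Lemma meval_mderiv0 (R : numDomainType) (n : nat) (q : {mpoly R[n]}) (i : 'I_n)
    (v w : 'I_n -> R) :
  q^`M(i) = 0 -> (forall j, j != i -> v j = w j) -> q.@[v] = q.@[w].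
Proof.
move=> q'0 vw; rewrite !mevalE; apply: eq_big_seq => m m_q; congr (_ * _).
apply: eq_bigr => j _; have [->|/vw->//] := eqVneq j i.
suff -> : m i = 0%N by rewrite !expr0.
apply/eqP; move: m_q; apply: contraTT => mi_neq0.
have := congr1 (mcoeff (m - U_(i))) q'0.
have le_im : (U_(i) <= m)%MM by rewrite lep1mP.
rewrite mcoeff_deriv submK // mcoeff0 => /eqP.
by rewrite mulrn_eq0 mcoeff_eq0.
Qed.

(** The last variable alone has the full weight n + 1, so the only monomial of t
    that it divides is this variable itself. *)
Lemma mderiv_max_weight (R : nzRingType) (n : nat) (t : {mpoly R[n.+1]}) :
  t \is n.+1.-homog for mnmwgt ->
  t^`M(ord_max) = (t@_(U_(ord_max)))%:MP.
Proof.
move=> /dhomogP t_homog; apply/mpolyP => m; rewrite mcoeff_deriv mcoeffC.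
have [->|m_neq0] := eqVneq m 0%MM; first by rewrite add0m mnm0E mulr1.
rewrite mulr0 memN_msupp_eq0 ?mul0rn //; apply/negP => /t_homog /eqP.
rewrite /= mnmwgtD mnmwgt1 -[X in _ == X]add0n eqn_add2r => /eqP w0.
move: m_neq0; rewrite -mdeg_eq0 -leqn0 -w0.
by rewrite leq_mdeg_mnmwgt.
Qed.

(** * Small perturbations of a polynomial with simple roots *)

(** The explicit bound, the inverse of one plus the sum of the inverses, avoids
    taking a minimum in a field that is only partially ordered. *)
Lemma finite_pos_lower_bound (R : numFieldType) (I : finType) (f : I -> R) :
  (forall i, 0 < f i) -> exists2 d, 0 < d & forall i, d <= f i.
Proof.
move=> f_gt0; have sum_ge0 (P : pred I) : 0 <= \sum_(i | P i) (f i)^-1.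
  by apply: sumr_ge0 => i _; rewrite invr_ge0 ltW.
exists (1 + \sum_i (f i)^-1)^-1 => [|i].
  by rewrite invr_gt0 ltr_pwDl.
rewrite -[leRHS]invrK lef_pV2 ?posrE ?invr_gt0 //; last by rewrite ltr_pwDl.
by rewrite (bigD1 i) //= addrCA lerDl addr_ge0.
Qed.

Lemma prod_XsubC_add_const (F : closedFieldType) (N : nat)
    (x : 'I_N.+1 -> F) (c : F) :
  exists z : 'I_N.+1 -> F,
    \prod_i ('X - (z i)%:P) = \prod_i ('X - (x i)%:P) + c%:P.
Proof.
set P := \prod_i ('X - (x i)%:P).
have sizeP : size P = N.+2.
  by rewrite size_prod_XsubC -[index_enum _]enumT size_enum_ord.
have lt_c : (size c%:P < size P)%N.
  by rewrite sizeP (leq_ltn_trans (size_polyC_leq1 c)).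
have [rs] := closed_field_poly_normal (P + c%:P).
rewrite lead_coefDl // (monicP (monic_prod_XsubC _ _ _)) scale1r => def_rs.
have size_rs : size rs == N.+1.
  have := congr1 (fun p : {poly F} => size p) def_rs.
  by rewrite /= size_polyDl // sizeP size_prod_XsubC => -[->].
by exists (tnth (Tuple size_rs)); rewrite def_rs (big_tuple _ _ (Tuple size_rs)).
Qed.

(** Continuity of simple roots.  If y_1, ..., y_(N+1) are the roots of the
    perturbed polynomial, then prod_i (x_j - y_i) = c, so a small c forces some
    y_i to be close to x_j.  Once close means less than half the distance
    between any two of the x_j, different j have different i, and the y_i can be
    numbered like the x_j. *)
Lemma roots_add_const_near (C : numClosedFieldType) (N : nat)
    (x : 'I_N.+1 -> C) (e : C) :
  injective x -> 0 < e ->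
  exists2 d, 0 < d & forall c, `|c| < d -> exists2 z : 'I_N.+1 -> C,
    \prod_i ('X - (z i)%:P) = \prod_i ('X - (x i)%:P) + c%:P &
    forall i, `|z i - x i| < e.
Proof.
move=> x_inj e_gt0.
(* A lower bound r of all the gaps is at most e (the diagonal pairs) and at most
   half the distance between distinct x_i and x_j. *)
pose gap (ij : 'I_N.+1 * 'I_N.+1) :=
  if ij.1 == ij.2 then e else `|x ij.1 - x ij.2| / 2.
have [|r r_gt0 r_le] := @finite_pos_lower_bound _ _ gap.
  move=> [i j]; rewrite /gap /=; case: eqP => // ij.
  by rewrite divr_gt0 ?ltr0n // normr_gt0 subr_eq0; apply/eqP => /x_inj.
have r_le_e : r <= e by have := r_le (ord0, ord0); rewrite /gap eqxx.
have r_le_sep i j : i != j -> r + r <= `|x i - x j|.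
  move=> /negPf ij; have := r_le (i, j).
  by rewrite /gap /= ij ler_pdivlMr ?ltr0n // mulr_natr mulr2n.
exists (r ^+ N.+1) => [|c c_lt]; first exact: exprn_gt0.
have [y def_y] := prod_XsubC_add_const x c.
have near_root j : exists i, `|x j - y i| < r.
  apply/existsP; apply: contraTT c_lt; rewrite negb_exists => /forallP far.
  have -> : c = \prod_i (x j - y i).
    have := congr1 (horner^~ (x j)) def_y.
    rewrite /= hornerD hornerC !horner_prod.
    rewrite [X in _ = X + _](bigD1 j) //= hornerXsubC subrr mul0r add0r => <-.
    by apply: eq_bigr => i _; rewrite hornerXsubC.
  have -> : r ^+ N.+1 = \prod_(i < N.+1) r by rewrite prodr_const card_ord.
  rewrite normr_prod -real_leNgt ?ger0_real ?prodr_ge0 //; last first.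
    by move=> i _; apply: ltW.
  apply: ler_prod => i _; rewrite (ltW r_gt0) /=.
  by rewrite real_leNgt ?far // ger0_real // ltW.
have [s near_s] := choice near_root.
have s_inj : injective s.
  move=> i j s_ij; apply/eqP; apply: contraT => /r_le_sep.
  rewrite lt_geF // -(subrKA (y (s i))) (le_lt_trans (ler_normD _ _)) //.
  by rewrite ltrD ?near_s // distrC s_ij near_s.
exists (y \o s) => [|i]; first by rewrite -def_y [RHS](reindex_inj s_inj).
by rewrite distrC (lt_le_trans (near_s i)).
Qed.

(** The change c is taken in the direction of a, so that the norms add up. *)
Lemma small_norm_change (R : numFieldType) (a d : R) :
  0 < d -> exists2 c, `|c| < d & `|a + c| != `|a|.
Proof.
move=> d_gt0; have d2_gt0 : 0 < d / 2 by rewrite divr_gt0.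
have lt_d2 : d / 2 < d by rewrite ltr_pdivrMr ?ltr0n // ltr_pMr // ltr1n.
have [->|a_neq0] := eqVneq a 0.
  exists (d / 2); first by rewrite gtr0_norm.
  by rewrite add0r normr0 normr_eq0 gt_eqF.
have a_gt0 : 0 < `|a| by rewrite normr_gt0.
exists (a / `|a| * (d / 2)).
  by rewrite normrM (gtr0_norm d2_gt0) normf_div normr_id divff ?gt_eqF ?mul1r.
have -> : a + a / `|a| * (d / 2) = a * (1 + (d / 2) / `|a|).
  by rewrite mulrDr mulr1 mulrAC mulrA.
have s_gt0 : 0 < d / 2 / `|a| by rewrite divr_gt0.
rewrite normrM (gtr0_norm (addr_gt0 ltr01 s_gt0)) mulrDr mulr1.
by rewrite -subr_eq0 addrAC subrr add0r mulf_neq0 // gt_eqF.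
Qed.

(** * Singular points with trivial stabilizer *)

(** The coordinates of p are the n + 2 distinct roots of T^(n+2) = a for some a.
    The ratio l of two of them satisfies l^(n+2) = 1, so multiplication by l
    permutes these roots, without fixing any: the permutation of the coordinates
    is not the identity and maps p to l p, which is the same projective point. *)
Lemma nontrivial_stabilizer_of_mesym0 (C : numClosedFieldType) (n : nat)
    (p : 'rV[C]_n.+2) :
  injective (p 0) ->
  (forall k, (0 < k <= n.+1)%N -> (mesym n.+2 C k).@[p 0] = 0) ->
  proj_stabilizer p != [set 1%g]%SET.
Proof.
move=> p_inj mesym0.
pose P : {poly C} := \prod_j ('X - (p 0 j)%:P).
have PE y : P.[y] = y ^+ n.+2 + P`_0.
  rewrite (@horner_coef_wide _ n.+3); last first.
    by rewrite size_prod_XsubC -[index_enum _]enumT size_enum_ord.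
  rewrite big_ord_recr big_ord_recl /= expr0 mulr1.
  have -> : P`_n.+2 = 1.
    by rewrite -[n.+2]subn0 coef_prod_XsubC_mesym // mul1r mesym0E meval1.
  rewrite mul1r big1 ?addr0 1?addrC // => i _; rewrite /bump leq0n add1n.
  have le_i : (i.+1 <= n.+2)%N by rewrite ltnS ltnW // ltn_ord.
  rewrite -[in P`_i.+1](subKn le_i) coef_prod_XsubC_mesym ?leq_subr //.
  by rewrite mesym0 ?mulr0 ?mul0r // subSS subn_gt0 ltn_ord leq_subr.
have root_p j : (p 0 j) ^+ n.+2 = - P`_0.
  apply/eqP; rewrite -addr_eq0 -PE; have : root P (p 0 j).
    by rewrite /P (bigD1 j) //= rootM root_XsubC eqxx.
  by [].
have [j pj_neq0] : exists j, p 0 j != 0.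
  have [p00|] := eqVneq (p 0 ord0) 0; last by exists ord0.
  exists ord_max; apply/eqP => pmax.
  by have := p_inj ord0 ord_max; rewrite p00 pmax => /(_ erefl).
have p_neq0 i : p 0 i != 0.
  by have := expf_neq0 n.+2 pj_neq0; rewrite root_p -(root_p i) expf_eq0.
pose l := p 0 ord_max / p 0 ord0.
have l_root : l ^+ n.+2 = 1.
  by rewrite exprMn exprVn !root_p divff // -(root_p j) expf_neq0.
have perm_l i : exists j, p 0 j = l * p 0 i.
  have : P.[l * p 0 i] == 0 by rewrite PE exprMn l_root mul1r root_p addNr.
  rewrite horner_prod => /prodf_eq0[j' _].
  by rewrite hornerXsubC subr_eq0 => /eqP ->; exists j'.
have [s sE] := choice perm_l.
have s_inj : injective s.
  move=> i k s_ik; apply: p_inj; apply: (@mulfI _ l); last by rewrite -!sE s_ik.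
  by rewrite mulf_neq0 ?invr_eq0.
apply/eqP => stab1.
have : perm s_inj \in proj_stabilizer p.
  rewrite inE; apply/eqmxP.
  have -> : col_perm (perm s_inj) p = l *: p.
    by apply/rowP => i; rewrite !mxE permE sE.
  by apply: eqmx_scale; rewrite mulf_neq0 ?invr_eq0.
rewrite stab1 inE => /eqP s1.
have := sE ord0; rewrite -(permE s_inj) s1 perm1 /l divfK // => /p_inj.
by [].
Qed.

(** Writing F = t(e_1, ..., e_(N+1)), the hypothesis at x says that dt vanishes at
    e(x); the constant derivative of t in its last variable is then zero, and
    neither t nor its derivatives see the value of e_(N+1), the only one that may
    differ between x and z. *)
Lemma singular_along_mesym_fiber (R : numFieldType) (N : nat)
    (F : {mpoly R[N.+1]}) (x z : 'I_N.+1 -> R) :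
  F \is symmetric -> F \is N.+1.-homog -> injective x ->
  (forall k, (F^`M(k)).@[x] = 0) ->
  (forall k, (k <= N)%N -> (mesym N.+1 R k).@[z] = (mesym N.+1 R k).@[x]) ->
  F.@[z] = F.@[x] /\ forall k, (F^`M(k)).@[z] = 0.
Proof.
move=> F_sym F_homog x_inj dFx zx.
have [t [tF t_homog]] := sym_fundamental_homog F_sym F_homog.
pose e (y : 'I_N.+1 -> R) (i : 'I_N.+1) := (mesym N.+1 R i.+1).@[y].
have eval_comp (q : {mpoly R[N.+1]}) y :
    (q \mPo [tuple mesym N.+1 R i.+1 | i < N.+1]).@[y] = q.@[e y].
  by rewrite comp_mpoly_meval; apply: meval_eq => i; rewrite tnth_mktuple.
have chain y k : (F^`M(k)).@[y] =
    \sum_i (t^`M(i)).@[e y] * ((mesym N.+1 R i.+1)^`M(k)).@[y].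
  rewrite -tF mderiv_comp raddf_sum /=; apply: eq_bigr => i _.
  by rewrite mevalM eval_comp tnth_mktuple.
have dt0 i : (t^`M(i)).@[e x] = 0.
  suff /rowP/(_ i) : \row_i (t^`M(i)).@[e x] = 0 by rewrite !mxE.
  apply: (can_inj (mulmxK (mesym_jacobian_unit x_inj))); rewrite mul0mx.
  apply/rowP => k; rewrite !mxE -[RHS](dFx k) chain.
  by apply: eq_bigr => j _; rewrite !mxE.
have dt_max : t^`M(ord_max) = 0.
  have := dt0 ord_max; rewrite mderiv_max_weight // mevalC => ->.
  by rewrite mpolyC0.
have e_eq j : j != ord_max -> e z j = e x j.
  move=> j_max; apply: zx; rewrite ltn_neqAle -ltnS ltn_ord andbT.
  by apply: contraNneq j_max => jN; apply/eqP/val_inj.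
split=> [|k]; first by rewrite -tF !eval_comp; exact: meval_mderiv0 dt_max e_eq.
rewrite chain big1 // => i _.
have -> : (t^`M(i)).@[e z] = (t^`M(i)).@[e x].
  by apply: (meval_mderiv0 _ e_eq); rewrite mderiv_comm dt_max mderiv0.
by rewrite dt0 mul0r.
Qed.

(** Otherwise the singular points z that share e_1, ..., e_(n+1) with p accumulate
    at p.  Isolatedness makes a nearby z proportional to p, and comparing the
    norms of e_(n+2) at p and z contradicts the choice of the perturbation. *)
Lemma singular_point_stabilizer (C : numClosedFieldType) (n : nat)
    (F : {mpoly C[n.+2]}) (p : 'rV[C]_n.+2) :
  F \is n.+2.-homog -> F \is symmetric -> isolated_singularities F ->
  singular_point F p -> proj_stabilizer p != [set 1%g]%SET.
Proof.
move=> F_homog F_sym F_isolated sing_p; have [_ Fp0 dFp] := sing_p.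
apply/eqP => stab_p.
have p_inj : injective (p 0).
  move=> i j pij; apply/eqP; apply: contraT => ij.
  have : tperm i j \in proj_stabilizer p.
    rewrite inE; suff -> : col_perm (tperm i j) p = p by apply/eqmxP.
    by apply/rowP => k; rewrite mxE; case: tpermP => [->|->|].
  rewrite stab_p inE => /eqP tij1; move: ij.
  by rewrite -(tpermL i j) tij1 perm1 eqxx.
have [k k_range ek_neq0] :
    exists2 k, (0 < k <= n.+1)%N & (mesym n.+2 _ k).@[p 0] != 0.
  apply: contrapT => all0.
  suff : proj_stabilizer p != [set 1%g]%SET by rewrite stab_p eqxx.
  apply: nontrivial_stabilizer_of_mesym0 p_inj _ => k k_range.
  by apply: contrapT => /eqP ek; apply: all0; exists k.
have /andP[k_gt0 k_le] := k_range.
have /nbhs_ballP[e /= e_gt0 isolated] := F_isolated p sing_p.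
have [d d_gt0 near_p] := roots_add_const_near p_inj e_gt0.
(* The sign makes this number the constant coefficient of the polynomial with
   the coordinates of p as roots, to which c is added. *)
have [c c_lt c_norm] :=
  small_norm_change ((-1) ^+ n.+2 * (mesym n.+2 _ n.+2).@[p 0]) d_gt0.
have [z def_z z_near] := near_p c c_lt.
have [ez_low ez_top] := mesym_add_const def_z.
pose q : 'rV[C]_n.+2 := \row_i z i.
have evalq (f : {mpoly C[n.+2]}) : f.@[q 0] = f.@[z].
  by apply: meval_eq => i; rewrite mxE.
have [Fz dFz] :=
  singular_along_mesym_fiber F_sym F_homog p_inj dFp ez_low.
have sing_q : singular_point F q.
  split=> [||i]; rewrite ?evalq ?Fz ?dFz ?Fp0 //.
  apply: contraNneq ek_neq0 => q0.
  have := meval_mesym_scale k 0 (p 0); rewrite expr0n gtn_eqF // mul0r => <-.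
  by rewrite -ez_low // -evalq q0; apply/eqP/meval_eq => i; rewrite mxE mul0r.
have /isolated/(_ sing_q) : ball p e q.
  by split=> // i j; rewrite ord1 /ball /= mxE distrC.
move=> /andP[/sub_rVP[l ql] _].
have ez j : (mesym n.+2 _ j).@[z] = l ^+ j * (mesym n.+2 _ j).@[p 0].
  rewrite -evalq -meval_mesym_scale; apply: meval_eq => i.
  by rewrite ql mxE.
have l_norm : `|l| = 1.
  have lk : l ^+ k = 1.
    by apply: (mulIf ek_neq0); rewrite mul1r -ez ez_low.
  have : `|l| ^+ k == 1 by rewrite -normrX lk normr1.
  by rewrite pexprn_eq1 // gtn_eqF //= => /eqP.
move/eqP: c_norm; apply; rewrite -ez_top ez mulrCA normrM.
by rewrite normrX l_norm expr1n mul1r.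
Qed.

Theorem theorem3p11 (R : realType) (n : nat) (F0 : {mpoly R[i][n.+2]})
    (F0_neq0 : F0 != 0)
    (F0_homog : F0 \is (n.+2).-homog)
    (F0_sym : F0 \is symmetric)
    (F0_isolated : isolated_singularities F0) :
  ~ exists p : 'rV[R[i]]_n.+2, node F0 p /\ proj_stabilizer p = [set 1%g]%SET.
Proof.
move=> [p [[sing_p _] stab_p]].
have := singular_point_stabilizer F0_homog F0_sym F0_isolated sing_p.
by rewrite stab_p eqxx.
Qed.
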